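(* Let $n\geq 3$, and let $R_{abcd}$ be a Riemann (curvature) tensor in dimension $n$ with metric $g_{ab}$, such that $R_{abcd}$ is positive definite as an operator on $2$-forms. Let $R^{*}=\ln R$ be the logarithm of this operator. Then there exists a symmetric tensor $\Pi_{ab}$ with $$R_{pijk}=\Pi_{pj}\Pi_{ik}-\Pi_{pk}\Pi_{ij}$$ if and only if the Weyl component $C^{*}_{abcd}$ of $R^{*}_{abcd}$ is $0$. Furthermore, in this case the only solutions are $\Pi_{ab}=\pm (e^{P^{*}})_{ab}$, where $P^{*}_{ab}$ is the Schouten component of $R^{*}_{abcd}$.
   Context: The setting is pointwise: a real $n$-dimensional vector space with positive definite inner product $g_{ab}$ (e.g. a tangent space of a Riemannian manifold), used to raise and lower indices, and $R_{abcd}$ has the algebraic symmetries of a curvature tensor, with the sign convention that $g_{ac}g_{bd}-g_{ad}g_{bc}$ is the curvature tensor of the unit round sphere. Any tensor $T_{abcd}$ antisymmetric in $ab$ and in $cd$ and satisfying $T_{abcd}=T_{cdab}$ is regarded as a self-adjoint operator on $2$-forms by $\omega_{ab}\mapsto \frac12 T_{ab}{}^{cd}\omega_{cd}$ (so $g_{ac}g_{bd}-g_{ad}g_{bc}$ is the identity operator), and conversely. Positive definite means all eigenvalues are positive. $R^{*}_{ab}{}^{cd}=\ln(R_{ab}{}^{cd})$ is the logarithm of the positive definite self-adjoint operator $R$, regarded again as a tensor $R^{*}_{abcd}$ with these symmetries. Components: put $R^{*}_{ij}=R^{*\,k}{}_{ikj}$, $\rho^{*}=R^{*\,a}{}_{a}$.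 The Schouten component is $$P^{*}_{ab}=\frac{1}{n-2}\left(R^{*}_{ab}-\frac{\rho^{*}}{2(n-1)}g_{ab}\right),$$ and the Weyl component is $$C^{*}_{abcd}=R^{*}_{abcd}-\left(g_{ac}P^{*}_{bd}+P^{*}_{ac}g_{bd}-P^{*}_{ad}g_{bc}-g_{ad}P^{*}_{bc}\right).$$ (These formulas are applied to $R^{*}$ even though it need not satisfy the first Bianchi identity.) $e^{P^{*}}$ is the exponential of the endomorphism $P^{*}_{a}{}^{b}$, with its index lowered by $g$. *)

(* Defs.v *)
From mathcomp Require Import all_boot all_order all_algebra.
From mathcomp Require Import all_classical all_reals all_analysis.
Set Implicit Arguments.
Unset Strict Implicit.
Unset Printing Implicit Defensive.
Import Order.TTheory GRing.Theory Num.Theory.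
Import numFieldNormedType.Exports.

Local Open Scope classical_set_scope.
Local Open Scope ring_scope.

(* Tensors are given by their components, all indices down, in an arbitrary
   (not necessarily orthonormal) basis, in which the inner product has Gram
   matrix g; indices are raised with the inverse matrix of g.  A tensor with
   two indices is a matrix, a 2-form an antisymmetric matrix. *)
Definition tensor4 (R : realType) (n : nat) : Type :=
  'I_n -> 'I_n -> 'I_n -> 'I_n -> R.

Section Tensors.
Context {R : realType} {n : nat}.
Implicit Types (g P Pi w M : 'M[R]_n) (T L : tensor4 R n) (l : R).

Definition inner_product g : Prop :=
  g^T = g /\ forall v : 'rV[R]_n, v != 0 -> 0 < (v *m g *m v^T) 0 0.

Definition two_form w : Prop := w^T = - w.

Definition selfadjoint_tensor T : Prop :=
  [/\ forall a b c d, T b a c d = - T a b c d,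
      forall a b c d, T a b d c = - T a b c d &
      forall a b c d, T c d a b = T a b c d].

Definition curvature_tensor T : Prop :=
  selfadjoint_tensor T /\
  forall a b c d, T a b c d + T a c d b + T a d b c = 0.

(* w_{ab} |-> (1/2) T_{abef} g^{ec} g^{fd} w_{cd} *)
Definition op_act g T w : 'M[R]_n :=
  \matrix_(a, b) (2^-1 * \sum_e \sum_f \sum_c \sum_d
    T a b e f * invmx g e c * invmx g f d * w c d).

Definition op_eigenvalue g T l : Prop :=
  exists w, [/\ two_form w, w != 0 & op_act g T w = l *: w].

Definition op_posdef g T : Prop := forall l, op_eigenvalue g T l -> 0 < l.

(* L is ln T in the sense of the functional calculus: L multiplies by ln l on
   the l-eigenspace of T. *)
Definition is_op_log g T L : Prop :=
  selfadjoint_tensor L /\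
  forall l w, two_form w -> op_act g T w = l *: w ->
    op_act g L w = ln l *: w.

(* For a selfadjoint tensor T, the spectral theorem provides exactly one such
   L, so the default value of the choice operator plays no role. *)
Definition op_log g T : tensor4 R n := get [set L | is_op_log g T L].

(* R_{ij} = R^k_{ikj} = g^{kl} R_{likj} *)
Definition ricci g T : 'M[R]_n :=
  \matrix_(i, j) \sum_k \sum_l invmx g k l * T l i k j.

Definition trace_g g P : R := \sum_a \sum_b invmx g a b * P a b.

Definition scalar_curvature g T : R := trace_g g (ricci g T).

Definition schouten g T : 'M[R]_n :=
  (n%:R - 2)^-1 *:
    (ricci g T - (scalar_curvature g T / (2 * (n%:R - 1))) *: g).

Definition weyl g T : tensor4 R n := fun a b c d =>
  let P := schouten g T in
  T a b c d -
  (g a c * P b d + P a c * g b d - P a d * g b c - g a d * P b c).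

Definition mx_exp M : 'M[R]_n :=
  limn (series (fun k : nat => k`!%:R^-1 *: M ^+ k)).

(* P *m invmx g is the endomorphism P_a^b, and *m g lowers the index back. *)
Definition tensor_exp g P : 'M[R]_n := mx_exp (P *m invmx g) *m g.

Definition square_factor T Pi : Prop :=
  Pi^T = Pi /\
  forall p i j k, T p i j k = Pi p j * Pi i k - Pi p k * Pi i j.

End Tensors.

(* Main.v *)
Require Import Defs.
From mathcomp Require Import all_boot all_order all_algebra.
From mathcomp Require Import all_classical all_reals all_analysis.
From HB Require Import structures.
From mathcomp Require Import spectral complex ring lra.
Set Implicit Arguments.
Unset Strict Implicit.
Unset Printing Implicit Defensive.
Import Order.TTheory GRing.Theory Num.Theory.
Import numFieldNormedType.Exports.

Local Open Scope ring_scope.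

(** Everything is diagonal in a suitable orthonormal frame.  Let A be the
matrix whose rows e_i are orthonormal for g and diagonalise a given symmetric
tensor P, with dual covectors theta_i and eigenvalues p_i.  A 2-form
theta_i /\ theta_j is then an eigenvector of the operator of the
Kulkarni-Nomizu product of g and P, with eigenvalue p_i + p_j, and of the
operator of P_{ac} P_{bd} - P_{ad} P_{bc}, with eigenvalue p_i p_j
([op_act_kulkarni], [op_act_square_factor]).  As these 2-forms span, a tensor
is determined by its action on them ([frame_ext]).  Since the logarithm turns
p_i p_j into ln p_i + ln p_j, it turns squares of Pi into Kulkarni-Nomizu
products of g with ln Pi, and those are exactly the tensors without Weyl
component.

If R is the square of Pi, with eigenvalues q_i, positivity of R says that
q_i q_j > 0 for all i <> j, so that all q_i have the same sign; up to replacing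
Pi by - Pi they are positive, and R* is the product of g with P = ln Pi
([square_factor_log]).  When n >= 3 the Schouten component of such a product
is P itself ([schouten_kulkarni]), hence the Weyl component vanishes and Pi is
the exponential of the Schouten component, up to sign.

Conversely, vanishing of the Weyl component says that R* is the product of g
with its Schouten component P.  In a frame diagonalising P, the form
theta_i /\ theta_j is an eigenvector of R* = ln R for p_i + p_j, hence of R for
e^{p_i + p_j} ([op_log_exp]), which is how the square of e^P acts
([kulkarni_square_factor]).

Both the diagonalisation of P relative to g and the diagonalisation of R on
forms, needed to know that ln R exists and determines R, are instances of the
spectral theorem for an operator that is self-adjoint for an arbitrary inner
product ([spectral_frame]). *)

(** * Simultaneous diagonalisation of symmetric bilinear forms *)

Lemma bilinear_sym (K : comPzRingType) m (M : 'M[K]_m) (u v : 'rV[K]_m) :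
  M^T = M -> (u *m M *m v^T) 0 0 = (v *m M *m u^T) 0 0.
Proof.
move=> sM; have -> : v *m M *m u^T = (u *m M *m v^T)^T.
  by rewrite !trmx_mul trmxK sM mulmxA.
by rewrite [RHS]mxE.
Qed.

(** The operator acts on row vectors by v |-> v C, and is self-adjoint for H when
C H is symmetric.  A complex eigenvector x + i y for the eigenvalue a + i b
gives x C = a x - b y and y C = a y + b x; comparing the H-products of x C with
y and of y C with x yields b (|x|^2 + |y|^2) = 0.  So b = 0, and the nonzero
one among x and y is a real eigenvector. *)
Lemma selfadjoint_eigenvector (R : realType) r (C H : 'M[R]_r) :
  (0 < r)%N -> inner_product H -> (C *m H)^T = C *m H ->
  exists l, exists2 z : 'rV[R]_r, z != 0 & z *m C = l *: z.
Proof.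
move=> r0 [sH pH] sCH.
have [l /eigenvalueP[z zE z0]] := eigenvalue_closed (map_mx (real_complex R) C) r0.
pose x : 'rV[R]_r := \row_j complex.Re (z 0 j).
pose y : 'rV[R]_r := \row_j complex.Im (z 0 j).
set a := complex.Re l; set b := complex.Im l.
have ReM (u v : R[i]) : complex.Re (u * v) =
    complex.Re u * complex.Re v - complex.Im u * complex.Im v.
  by case: u v => [? ?] [? ?].
have ImM (u v : R[i]) : complex.Im (u * v) =
    complex.Re u * complex.Im v + complex.Im u * complex.Re v.
  by case: u v => [? ?] [? ?].
have zE' j : l * z 0 j = \sum_k z 0 k * (C k j)%:C%C.
  by have /rowP/(_ j) := zE; rewrite !mxE => <-; apply: eq_bigr => k _; rewrite mxE.
have xE : x *m C = a *: x + - b *: y.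
  apply/rowP => j; rewrite !mxE mulNr -ReM zE' (raddf_sum (@complex.Re R)) /=.
  by apply: eq_bigr => k _; rewrite ReM mxE /= mulr0 subr0.
have yE : y *m C = a *: y + b *: x.
  apply/rowP => j; rewrite !mxE -ImM zE' (raddf_sum (@complex.Im R)) /=.
  by apply: eq_bigr => k _; rewrite ImM mxE /= mulr0 add0r.
have xy0 : (x != 0) || (y != 0).
  rewrite -negb_and; apply: contra z0 => /andP[/eqP x0 /eqP y0].
  apply/eqP/rowP => j; move/rowP/(_ j): x0; move/rowP/(_ j): y0.
  by rewrite !mxE; case: (z 0 j) => u v /= -> ->.
have ge0 (v : 'rV_r) : 0 <= (v *m H *m v^T) 0 0.
  have [->|/pH/ltW//] := eqVneq v 0.
  by rewrite !mul0mx mxE.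
have q0 : 0 < (x *m H *m x^T) 0 0 + (y *m H *m y^T) 0 0.
  by case/orP: xy0 => /pH h; [apply: ltr_pwDl|apply: ltr_wpDl].
have b0 : b = 0.
  have := bilinear_sym x y sCH.
  have BL (u v w : 'rV_r) c d : ((c *: u + d *: v) *m H *m w^T) 0 0 =
      c * (u *m H *m w^T) 0 0 + d * (v *m H *m w^T) 0 0.
    rewrite !mulmxDl -!scalemxAl mxE.
    by rewrite [X in X + _ = _]mxE [X in _ + X = _]mxE.
  rewrite !mulmxA xE yE !BL.
  rewrite (bilinear_sym y x sH).
  set p := (x *m H *m x^T) 0 0 in q0 *; set q := (y *m H *m y^T) 0 0 in q0 *.
  move=> h; have /eqP : b * (p + q) = 0 by rewrite mulrDr; lra.
  by rewrite mulf_eq0 (gt_eqF q0) orbF => /eqP.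
exists a; case/orP: xy0 => h; [exists x|exists y] => //.
- by rewrite xE b0 oppr0 scale0r addr0.
- by rewrite yE b0 scale0r addr0.
Qed.

(** The spectral theorem for an operator F self-adjoint for the inner product G:
the rows of A are a G-orthonormal basis of eigenvectors.  Orthonormal
families of eigenvectors are extended one vector at a time: the G-orthogonal
complement of k of them is nonzero as long as k < N, is stable under F, and so
contains a further eigenvector. *)
Lemma spectral_frame (R : realType) N (G F : 'M[R]_N) :
  inner_product G -> (F *m G)^T = F *m G ->
  exists (A : 'M[R]_N) d, A *m G *m A^T = 1%:M /\ A *m F = diag_mx d *m A.
Proof.
move=> iG sFG; have [sG pG] := iG.
suff H k : (k <= N)%N -> exists (A : 'M[R]_(k, N)) (d : 'rV_k),
    A *m G *m A^T = 1%:M /\ A *m F = diag_mx d *m A by apply: H.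
elim: k => [_|k IH kN].
  by exists 0, 0; split; apply/matrixP => -[].
have [A [d [AA AF]]] := IH (ltnW kN).
(* The rows of B are a basis of the G-orthogonal complement of the rows of A. *)
have [r [B [r0 B0 Bfree Bfull]]] : exists (r : nat) (B : 'M[R]_(r, N)),
    [/\ (0 < r)%N, B *m (G *m A^T) = 0, row_free B &
      forall (X : 'M[R]_(r, N)), X *m (G *m A^T) = 0 -> exists C : 'M[R]_r, X = C *m B].
  exists (\rank (kermx (G *m A^T))), (row_base (kermx (G *m A^T))).
  split; [|by apply/sub_kermxP; rewrite eq_row_base|exact: row_base_free|].
    by rewrite mxrank_ker subn_gt0; apply: leq_ltn_trans (rank_leq_col _) kN.
  by move=> X /sub_kermxP h; apply/submxP; rewrite eq_row_base.
have GF : G *m F^T = F *m G by rewrite -sFG trmx_mul sG.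
(* C is the matrix in that basis of the restriction of F to the complement. *)
have [C CE] : exists C, B *m F = C *m B.
  apply: Bfull; rewrite mulmxA -(mulmxA B) -GF -!mulmxA -trmx_mul AF trmx_mul.
  by rewrite tr_diag_mx (mulmxA G) mulmxA B0 mul0mx.
have BI (v : 'rV_r) : v != 0 -> v *m B != 0.
  apply: contra => /eqP h; apply/eqP; apply: (row_free_inj Bfree).
  by rewrite h mul0mx.
have iH : inner_product (B *m G *m B^T).
  split=> [|v /BI /pG]; first by rewrite !trmx_mul trmxK sG mulmxA.
  by rewrite trmx_mul !mulmxA.
have [|l [z /BI v0 zE]] := selfadjoint_eigenvector r0 iH (C := C).
  by rewrite !mulmxA -CE -(mulmxA B) trmx_mul (trmx_mul B) sFG trmxK mulmxA.
set v := z *m B in v0.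
have vF : v *m F = l *: v by rewrite /v -mulmxA CE mulmxA zE scalemxAl.
have vA : v *m G *m A^T = 0 by rewrite /v -!mulmxA B0 mulmx0.
clearbody v.
have Av : A *m G *m v^T = 0.
  by apply: trmx_inj; rewrite !trmx_mul trmxK sG mulmxA vA trmx0.
have q0 := pG v v0; set q := (v *m G *m v^T) 0 0 in q0.
have vv : v *m G *m v^T = q%:M by rewrite [LHS]mx11_scalar.
pose s := (Num.sqrt q)^-1.
have ss : s * s * q = 1.
  rewrite -expr2 exprVn sqr_sqrtr ?ltW// mulVf// gt_eqF//.
exists (col_mx (s *: v) A : 'M[R]_(1 + k, N)), (row_mx l%:M d : 'rV_(1 + k)); split.
  rewrite (@mul_col_mx _ 1 k) (@tr_col_mx _ 1 k) (@mul_col_row _ 1 k _ 1 k).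
  rewrite [RHS](@scalar_mx_block _ 1 k) AA linearZ /= -!scalemxAl -!scalemxAr.
  by rewrite vA Av vv !scaler0 scalerA scale_scalar_mx ss.
rewrite (@mul_col_mx _ 1 k) (@diag_mx_row _ k 1) (@mul_block_col _ 1 k 1 k).
rewrite !mul0mx addr0 add0r AF.
congr (@col_mx R 1 k N _ _); rewrite -scalemxAl vF.
have -> : diag_mx l%:M = l%:M :> 'M[R]_1 by apply/matrixP => i j; rewrite !ord1 !mxE.
by rewrite mul_scalar_mx !scalerA mulrC.
Qed.

(** * The exponential of a diagonalised matrix *)

(** With E_k the projections onto the eigenlines, the partial sums of the matrix
series are combinations of the fixed matrices E_k, whose coefficients are the
partial sums of the scalar series. *)
Lemma mx_exp_diag (R : realType) n (B C : 'M[R]_n) (p : 'rV[R]_n) :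
  C *m B = 1%:M ->
  mx_exp (B *m diag_mx p *m C) = B *m diag_mx (map_mx expR p) *m C.
Proof.
move=> CB; have BC := mulmx1C CB.
pose E k : 'M[R]_n := B *m delta_mx k k *m C.
have diagE (q : 'rV[R]_n) : B *m diag_mx q *m C = \sum_k q 0 k *: E k.
  rewrite diag_mx_sum_delta mulmx_sumr mulmx_suml; apply: eq_bigr => k _.
  by rewrite -scalemxAr -scalemxAl.
have powE m : (B *m diag_mx p *m C) ^+ m =
    B *m diag_mx (map_mx (fun x => x ^+ m) p) *m C.
  elim: m => [|m IH].
    rewrite expr0; have -> : map_mx (fun x => x ^+ 0) p = const_mx 1.
      by apply/rowP => i; rewrite !mxE.
    by rewrite diag_const_mx mulmx1 BC.
  rewrite exprS IH -[LHS]/(_ *m _) !mulmxA -(mulmxA _ C) CB mulmx1.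
  congr (_ *m _); rewrite -mulmxA mulmx_diag; congr (_ *m diag_mx _).
  by apply/rowP => i; rewrite !mxE exprS.
rewrite [RHS]diagE /mx_exp.
have -> : series (fun k : nat => k`!%:R^-1 *: (B *m diag_mx p *m C) ^+ k) =
    (fun N => \sum_k series (exp_coeff (p 0 k)) N *: E k).
  apply/funext => N; rewrite /series /=.
  under eq_bigr do rewrite powE diagE scaler_sumr.
  rewrite exchange_big /=; apply: eq_bigr => k _; rewrite scaler_suml.
  by apply: eq_bigr => m _; rewrite scalerA mxE mulrC.
apply: cvg_lim; first exact: norm_hausdorff.
apply: cvg_big => [x|k _]; first exact: add_continuous.
rewrite mxE; apply: cvgZr_tmp; exact: is_cvg_series_exp_coeff.
Qed.

(** * The operator of a tensor on 2-forms *)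

(** The inner product that g induces on all covariant 2-tensors, which is
positive definite on them; on 2-forms it is twice the usual inner product.
Working on the space of all matrices avoids choosing a basis of 2-forms: the
operator of a tensor vanishes on the symmetric ones. *)
Definition form_ip (R : realType) n (g w w' : 'M[R]_n) : R :=
  \sum_e \sum_f (invmx g *m w *m invmx g) e f * w' e f.

Section OpAct.
Variables (R : realType) (n : nat) (g : 'M[R]_n).
Hypothesis ig : inner_product g.
Implicit Types (T L : tensor4 R n) (w : 'M[R]_n).

Lemma frame_inv (A : 'M[R]_n) : A *m g *m A^T = 1%:M -> invmx g = A^T *m A.
Proof.
rewrite -mulmxA => /mulmx1C; rewrite -mulmxA => h.
have [gU _] := mulmx1_unit h.
by rewrite -[RHS]mul1mx -(mulVmx gU) -mulmxA h mulmx1.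
Qed.

Lemma metric_unit : g \in unitmx.
Proof.
have [_ pg] := ig; rewrite unitmxE unitfE; apply/det0P => -[v /pg + vg].
by rewrite vg mul0mx mxE ltxx.
Qed.

(** The rows of A are an orthonormal frame, the columns of g A^T its dual coframe,
and p lists the eigenvalues of P relative to g. *)
Lemma frame_exists (P : 'M[R]_n) : P^T = P ->
  exists (A : 'M[R]_n) p,
    A *m g *m A^T = 1%:M /\ P *m A^T = g *m A^T *m diag_mx p.
Proof.
move=> sP; have [sg _] := ig.
have [|A [p [Ag AP]]] := @spectral_frame R n g (P *m invmx g) ig.
  by rewrite mulmxKV// metric_unit.
exists A, p; split=> //.
apply: trmx_inj; rewrite !trmx_mul !trmxK tr_diag_mx sP sg mulmxA -AP.
by rewrite mulmxA mulmxKV// metric_unit.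
Qed.

Lemma invmx_metric_sym : (invmx g)^T = invmx g.
Proof. by case: ig => sg _; rewrite trmx_inv sg. Qed.

Lemma op_actE T w a b : op_act g T w a b =
  2^-1 * \sum_e \sum_f T a b e f * (invmx g *m w *m invmx g) e f.
Proof.
rewrite mxE; congr (_ * _); apply: eq_bigr => e _; apply: eq_bigr => f _.
rewrite mxE mulr_sumr exchange_big /=; apply: eq_bigr => d _.
rewrite mxE mulr_suml mulr_sumr; apply: eq_bigr => c _.
have -> : invmx g d f = invmx g f d by rewrite -[in LHS]invmx_metric_sym mxE.
ring.
Qed.

Lemma op_act_is_linear T : linear (op_act g T).
Proof.
move=> c w w'; apply/matrixP => a b; rewrite op_actE 2!mxE !op_actE.
rewrite !mulr_sumr -big_split; apply: eq_bigr => e _ /=.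
rewrite !mulr_sumr -big_split; apply: eq_bigr => f _ /=.
rewrite mulmxDr mulmxDl -scalemxAr -scalemxAl [in LHS]mxE [in LHS]mxE; ring.
Qed.

HB.instance Definition _ T := GRing.isLinear.Build R 'M[R]_n 'M[R]_n *:%R
  (op_act g T) (op_act_is_linear T).

Lemma form_ipE w w' : form_ip g w w' = \tr (invmx g *m w *m invmx g *m w'^T).
Proof.
by apply: eq_bigr => e _; rewrite [RHS]mxE; apply: eq_bigr => f _;
  rewrite [w'^T _ _]mxE.
Qed.

Lemma form_ipC w w' : form_ip g w w' = form_ip g w' w.
Proof.
rewrite !form_ipE -mxtrace_tr !trmx_mul trmxK invmx_metric_sym.
by rewrite -!mulmxA [RHS]mxtrace_mulC !mulmxA.
Qed.

Lemma form_ipZl c w w' : form_ip g (c *: w) w' = c * form_ip g w w'.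
Proof. by rewrite !form_ipE -scalemxAr -!scalemxAl linearZ. Qed.

Lemma form_ipZr c w w' : form_ip g w (c *: w') = c * form_ip g w w'.
Proof. by rewrite form_ipC form_ipZl form_ipC. Qed.

(** In the coordinates of an orthonormal frame this is the sum of the squares of
the entries. *)
Lemma form_ip_gt0 w : w != 0 -> 0 < form_ip g w w.
Proof.
move=> w0; have [sg _] := ig; have [A [_ [Ag _]]] := frame_exists sg.
have -> : form_ip g w w = \tr ((A *m w *m A^T) *m (A *m w *m A^T)^T).
  rewrite form_ipE (frame_inv Ag) !trmx_mul !trmxK.
  by rewrite -!mulmxA mxtrace_mulC !mulmxA.
have X0 : A *m w *m A^T != 0.
  apply: contra w0 => /eqP X0.
  have /mulmx1C AT : A *m (g *m A^T) = 1%:M by rewrite mulmxA.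
  have AT' : A^T *m (A *m g) = 1%:M by apply: mulmx1C.
  have -> : w = (g *m A^T) *m (A *m w *m A^T) *m (A *m g).
    by rewrite -[LHS]mul1mx -[LHS]mulmx1 -{1}AT -AT' !mulmxA.
  by rewrite X0 mulmx0 mul0mx.
set X := A *m w *m A^T in X0 *.
have h e f : 0 <= X e f * X^T f e by rewrite [X^T _ _]mxE -expr2 sqr_ge0.
have h' e : 0 <= (X *m X^T) e e by rewrite mxE sumr_ge0.
rewrite lt_neqAle sumr_ge0 ?andbT//; apply: contra X0 => /eqP/esym tr0.
apply/eqP/matrixP => e f; rewrite [RHS]mxE; apply/eqP; rewrite -sqrf_eq0.
have := psumr_eq0P (fun e _ => h' e) tr0 (i := e) isT; rewrite mxE => Xe.
have := psumr_eq0P (fun f _ => h e f) Xe (i := f) isT.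
by rewrite [X^T _ _]mxE -expr2 => ->.
Qed.

Lemma op_act_selfadjoint T w w' : selfadjoint_tensor T ->
  form_ip g (op_act g T w) w' = form_ip g w (op_act g T w').
Proof.
move=> [_ _ sT]; rewrite [LHS]form_ipC /form_ip.
pose X := invmx g *m w *m invmx g; pose Y := invmx g *m w' *m invmx g.
transitivity (\sum_a \sum_b Y a b * op_act g T w a b) => //.
transitivity (\sum_a \sum_b X a b * op_act g T w' a b) => //.
transitivity (\sum_a \sum_b \sum_e \sum_f 2^-1 * (Y a b * T a b e f * X e f)).
  apply: eq_bigr => a _; apply: eq_bigr => b _; rewrite op_actE !mulr_sumr.
  apply: eq_bigr => e _; rewrite !mulr_sumr; apply: eq_bigr => f _.
  by rewrite -/X; ring.
transitivity (\sum_e \sum_f \sum_a \sum_b 2^-1 * (Y a b * T a b e f * X e f)).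
  under eq_bigr do rewrite exchange_big /=.
  rewrite exchange_big /=; apply: eq_bigr => e _.
  under eq_bigr do rewrite exchange_big /=.
  by rewrite exchange_big.
apply: eq_bigr => a _; apply: eq_bigr => b _; rewrite op_actE !mulr_sumr.
apply: eq_bigr => e _; rewrite !mulr_sumr; apply: eq_bigr => f _.
by rewrite -/Y sT; ring.
Qed.

Lemma mxvec_dot (X Y : 'M[R]_n) :
  (mxvec X *m (mxvec Y)^T) 0 0 = \sum_a \sum_b X a b * Y a b.
Proof.
rewrite mxE pair_big (reindex _ (curry_mxvec_bij _ _)) /=.
by apply: eq_bigr => -[a b] _ /=; rewrite mxE !mxvecE.
Qed.

(** The spectral theorem on the space of all matrices, seen as row vectors of
length n * n; the second clause is the expansion in the orthonormal basis u. *)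
Lemma spectral_forms T : selfadjoint_tensor T ->
  exists (u : 'I_(n * n) -> 'M[R]_n) (d : 'I_(n * n) -> R),
    (forall k, op_act g T (u k) = d k *: u k) /\
    (forall w, w = \sum_k form_ip g w (u k) *: u k).
Proof.
move=> sT.
pose G := lin_mx (mulmxr (invmx g) \o mulmx (invmx g)).
have GE (v v' : 'rV_(n * n)) : (v *m G *m v'^T) 0 0 = form_ip g (vec_mx v) (vec_mx v').
  by rewrite -[v]vec_mxK -[v']vec_mxK mul_vec_lin mxvec_dot !mxvecK.
have symM (M : 'M[R]_(n * n)) :
    (forall v v' : 'rV_(n * n), (v *m M *m v'^T) 0 0 = (v' *m M *m v^T) 0 0) -> M^T = M.
  move=> h; apply/matrixP => i j; rewrite mxE.
  have := h (delta_mx 0 i) (delta_mx 0 j).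
  by rewrite -!rowE !trmx_delta -!colE !mxE.
have iG : inner_product G.
  split=> [|v v0]; first by apply: symM => v v'; rewrite !GE form_ipC.
  rewrite GE form_ip_gt0//; apply: contra v0 => /eqP h.
  by rewrite -[v]vec_mxK h linear0.
have [|U [d [UG UF]]] := @spectral_frame R (n * n) G (lin_mx (op_act g T)) iG.
  apply: symM => v v'; rewrite !mulmxA !GE -[v]vec_mxK -[v']vec_mxK !mul_vec_lin.
  by rewrite !mxvecK op_act_selfadjoint// form_ipC.
exists (fun k => vec_mx (row k U)), (fun k => d 0 k); split=> [k|w].
  apply: (can_inj mxvecK); rewrite -mul_vec_lin vec_mxK -row_mul UF.
  by rewrite linearZ /= vec_mxK mul_diag_mx; apply/rowP => j; rewrite !mxE.
have /mulmx1C h : U *m (G *m U^T) = 1%:M by rewrite mulmxA.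
apply: (can_inj mxvecK); rewrite -[LHS]mulmx1 -h mulmxA mulmx_sum_row linear_sum.
apply: eq_bigr => k _; rewrite linearZ /= vec_mxK; congr (_ *: _).
rewrite mulmxA -[w in RHS]mxvecK -GE [LHS]mxE [RHS]mxE.
by apply: eq_bigr => j _; rewrite !mxE.
Qed.

End OpAct.

(** * The logarithm of a positive operator *)

Section Log.
Variables (R : realType) (n : nat) (g : 'M[R]_n).
Hypothesis ig : inner_product g.
Implicit Types (T L : tensor4 R n) (w : 'M[R]_n).

Lemma op_act_tr T w : selfadjoint_tensor T -> op_act g T w^T = - op_act g T w.
Proof.
move=> [_ aT _]; apply/matrixP => a b; rewrite [RHS]mxE !(op_actE ig).
have -> : invmx g *m w^T *m invmx g = (invmx g *m w *m invmx g)^T.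
  by rewrite !trmx_mul invmx_metric_sym// mulmxA.
rewrite exchange_big /= -mulrN -sumrN; congr (_ * _); apply: eq_bigr => e _.
by rewrite -sumrN; apply: eq_bigr => f _; rewrite (aT a b e f) mxE mulNr.
Qed.

Lemma tr_op_act T w : selfadjoint_tensor T -> (op_act g T w)^T = - op_act g T w.
Proof.
move=> [aT _ _]; apply/matrixP => a b; rewrite [LHS]mxE [RHS]mxE !(op_actE ig).
rewrite -mulrN -sumrN; congr (_ * _); apply: eq_bigr => e _.
by rewrite -sumrN; apply: eq_bigr => f _; rewrite aT mulNr.
Qed.

(** The image of the operator consists of 2-forms. *)
Lemma eigenform_two_form T l w : selfadjoint_tensor T -> l != 0 ->
  op_act g T w = l *: w -> two_form w.
Proof.
move=> sT l0 e; have := tr_op_act w sT; rewrite e linearZ /= -scalerN.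
by move/(scalerI l0).
Qed.

(** ln T is the sum of the ln (d_k) u_k (x) u_k over an orthonormal eigenbasis u;
the factor 2 compensates the 1/2 in the action of a tensor.  The antisymmetry
of the sum rests on the convention ln 0 = 0: an eigenvector that is not a
2-form has eigenvalue 0 and does not contribute. *)
Lemma op_log_exists T : selfadjoint_tensor T -> exists L, is_op_log g T L.
Proof.
move=> sT; have [u [d [ud uw]]] := spectral_forms ig sT.
have anti k a b : ln (d k) * u k b a = - (ln (d k) * u k a b).
  have [->|d0] := eqVneq (d k) 0; first by rewrite ln0// !mul0r oppr0.
  have /matrixP/(_ a b) := eigenform_two_form sT d0 (ud k).
  by rewrite !mxE => ->; rewrite mulrN.
exists (fun a b c e => 2 * \sum_k ln (d k) * u k a b * u k c e); split.
  split=> [a b c e|a b c e|a b c e].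
  - rewrite -mulrN -sumrN; congr (_ * _); apply: eq_bigr => k _.
    by rewrite anti mulNr.
  - rewrite -mulrN -sumrN; congr (_ * _); apply: eq_bigr => k _.
    by rewrite mulrAC (anti k c e) mulNr [in RHS]mulrAC.
  - by congr (_ * _); apply: eq_bigr => k _; rewrite mulrAC.
move=> l w tw Tw.
(* Eigenvectors for distinct eigenvalues are orthogonal. *)
have c k : ln (d k) * form_ip g w (u k) = ln l * form_ip g w (u k).
  have := op_act_selfadjoint ig w (u k) sT.
  rewrite Tw ud form_ipZl form_ipZr// => /eqP.
  rewrite -subr_eq0 -mulrBl mulf_eq0 subr_eq0.
  by case/orP => /eqP ->; rewrite ?mulr0.
transitivity (\sum_k (ln (d k) * form_ip g w (u k)) *: u k).
  apply/matrixP => a b; rewrite (op_actE ig) summxE.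
  transitivity (\sum_k \sum_e \sum_f ln (d k) * u k a b *
      ((invmx g *m w *m invmx g) e f * u k e f)).
    rewrite mulr_sumr exchange_big /=; apply: eq_bigr => e _.
    rewrite mulr_sumr exchange_big /=; apply: eq_bigr => f _.
    rewrite mulrA mulrA mulVf// mul1r mulr_suml; apply: eq_bigr => k _.
    ring.
  apply: eq_bigr => k _; rewrite mxE /form_ip mulrAC mulr_sumr.
  by apply: eq_bigr => e _; rewrite mulr_sumr.
rewrite [w in RHS]uw scaler_sumr; apply: eq_bigr => k _.
by rewrite c scalerA.
Qed.

Lemma op_logP T : selfadjoint_tensor T -> is_op_log g T (op_log g T).
Proof.
by move=> /op_log_exists[L]; exact: (@getI _ [set L | is_op_log g T L]%classic).
Qed.

(** A positive operator is the exponential of its logarithm: expand w in an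
eigenbasis u of T.  Where w has a nonzero component along u_k, the logarithm
has both eigenvalues m and ln (d_k) there, as it is self-adjoint.  An
eigenvector u_k for the eigenvalue 0 is symmetric, since its antisymmetric
part would contradict positivity; it is therefore orthogonal to w. *)
Lemma op_log_exp T L m w : selfadjoint_tensor T -> op_posdef g T ->
  is_op_log g T L -> two_form w ->
  op_act g L w = m *: w -> op_act g T w = expR m *: w.
Proof.
move=> sT pT [sL LT] tw Lw; have [u [d [ud uw]]] := spectral_forms ig sT.
rewrite {1 2}(uw w) linear_sum scaler_sumr; apply: eq_bigr => k _.
rewrite linearZ /= ud !scalerA mulrC.
have [->|u0] := eqVneq (u k) 0; first by rewrite !scaler0.
congr (_ *: _).
have [d0|d0] := eqVneq (d k) 0.
  suff -> : form_ip g w (u k) = 0 by rewrite !mulr0.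
  have su : u k = (u k)^T.
    apply/eqP/negPn/negP; rewrite -subr_eq0 => ut0.
    have /pT : op_eigenvalue g T 0.
      exists (u k - (u k)^T); split=> //.
        by rewrite /two_form linearB /= trmxK opprB.
      by rewrite linearB /= op_act_tr// ud d0 !scale0r oppr0 subr0.
    by rewrite ltxx.
  have : form_ip g w (u k) = - form_ip g w (u k).
    rewrite {1}form_ipE// -mxtrace_tr !trmx_mul !trmxK tw invmx_metric_sym//.
    rewrite mxtrace_mulC {1}su !(mulNmx, mulmxN) !mulmxA linearN /=.
    by rewrite -form_ipE.
  by move=> h; lra.
have tu := eigenform_two_form sT d0 (ud k).
have dk : 0 < d k by apply: pT; exists (u k).
have := op_act_selfadjoint ig w (u k) sL.
rewrite Lw (LT (d k))// form_ipZl form_ipZr// => /eqP.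
rewrite -subr_eq0 -mulrBl mulf_eq0 subr_eq0.
by case/orP => /eqP ->; rewrite ?mulr0// lnK.
Qed.

End Log.

(** * Tensors diagonal on the 2-forms of a frame *)

(** The Kulkarni-Nomizu product.  The trace part of the Weyl decomposition is the
product of g with the Schouten component, and the square of Pi is half the
product of Pi with itself. *)
Definition kulkarni (R : realType) n (P Q : 'M[R]_n) : tensor4 R n := fun a b c d =>
  P a c * Q b d + Q a c * P b d - P a d * Q b c - Q a d * P b c.

Lemma mulmx_delta (K : comPzRingType) m n p q (X : 'M[K]_(m, n))
    (Y : 'M[K]_(p, q)) k l a b :
  (X *m delta_mx k l *m Y) a b = X a k * Y l b.
Proof.
rewrite -(mul_delta_mx (0 : 'I_1)) mulmxA -mulmxA -colE -rowE.
by rewrite mxE big_ord1 !mxE.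
Qed.

Section Frame.
Variables (R : realType) (n : nat) (g : 'M[R]_n).
Hypothesis ig : inner_product g.
Implicit Types (T L : tensor4 R n) (w P Q : 'M[R]_n).
Variable A : 'M[R]_n.
Hypothesis Ag : A *m g *m A^T = 1%:M.

Let coframe := g *m A^T.

(** theta_i /\ theta_j. *)
Definition frame_form i j : 'M[R]_n :=
  coframe *m (delta_mx i j - delta_mx j i) *m coframe^T.

Lemma frame_coK : A *m coframe = 1%:M. Proof. by rewrite mulmxA. Qed.
Lemma coframeK : coframe *m A = 1%:M. Proof. exact/mulmx1C/frame_coK. Qed.
Lemma coframe_inj m : injective (fun X : 'M[R]_(m, n) => X *m A^T).
Proof.
move=> X Y /(congr1 (mulmx^~ coframe^T)).
by rewrite -!mulmxA -trmx_mul coframeK trmx1 !mulmx1.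
Qed.

Lemma frame_formE i j a b :
  frame_form i j a b = coframe a i * coframe b j - coframe a j * coframe b i.
Proof.
rewrite /frame_form mulmxBr mulmxBl mxE [X in _ + X]mxE !mulmx_delta.
by rewrite ![coframe^T _ _]mxE.
Qed.

Lemma frame_form_two i j : two_form (frame_form i j).
Proof.
by apply/matrixP => a b; rewrite [LHS]mxE [RHS]mxE !frame_formE; ring.
Qed.

Lemma frame_form_neq0 i j : i != j -> frame_form i j != 0.
Proof.
move=> ij; apply/eqP => h.
have : A *m frame_form i j *m A^T = 0 by rewrite h mulmx0 mul0mx.
rewrite /frame_form -!(mulmxA _ _ A^T) -trmx_mul frame_coK trmx1.
rewrite mulmx1 (mulmxA A) frame_coK mul1mx.
move/matrixP/(_ i j)/eqP.
by rewrite !mxE !eqxx (negbTE ij) subr0 oner_eq0.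
Qed.

(** Raising both indices of theta_i /\ theta_j gives e_i /\ e_j; the factor 1/2
cancels against the two orders of e_i and e_j. *)
Lemma op_act_frame T i j a b : (forall a b c d, T a b d c = - T a b c d) ->
  op_act g T (frame_form i j) a b = \sum_e \sum_f T a b e f * (A i e * A j f).
Proof.
move=> aT; rewrite (op_actE ig).
have E e f : (invmx g *m frame_form i j *m invmx g) e f = A i e * A j f - A j e * A i f.
  have h : invmx g *m coframe = A^T by rewrite (frame_inv Ag) -mulmxA frame_coK mulmx1.
  have h' : coframe^T *m invmx g = A.
    by apply: trmx_inj; rewrite trmx_mul trmxK invmx_metric_sym.
  have -> : invmx g *m frame_form i j *m invmx g =
      A^T *m (delta_mx i j - delta_mx j i) *m A.
    by rewrite -[in RHS]h -[in RHS]h' !mulmxA.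
  rewrite mulmxBr mulmxBl mxE [X in _ + X]mxE.
  by rewrite !mulmx_delta ![A^T _ _]mxE.
under eq_bigr do under eq_bigr do rewrite E mulrBr.
under eq_bigr do rewrite sumrB.
rewrite sumrB [X in _ - X]exchange_big /=.
have -> : \sum_f \sum_e T a b e f * (A j e * A i f) =
    - \sum_e \sum_f T a b e f * (A i e * A j f).
  rewrite -sumrN; apply: eq_bigr => e _; rewrite -sumrN; apply: eq_bigr => f _.
  by rewrite aT; ring.
lra.
Qed.

(** By [op_act_frame] the last hypothesis compares the components along e_i and
e_j in the last two slots, and the e_i form a basis. *)
Lemma frame_ext T T' :
  (forall a b c d, T a b d c = - T a b c d) ->
  (forall a b c d, T' a b d c = - T' a b c d) ->
  (forall i j, op_act g T (frame_form i j) = op_act g T' (frame_form i j)) ->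
  forall a b c d, T a b c d = T' a b c d.
Proof.
move=> aT aT' h a b c d.
pose M S : 'M[R]_n := \matrix_(e, f) (S a b e f : R).
have E S : (forall a b c d, S a b d c = - S a b c d) ->
    A *m M S *m A^T = \matrix_(i, j) op_act g S (frame_form i j) a b.
  move=> aS; apply/matrixP => i j; rewrite [RHS]mxE op_act_frame//.
  rewrite mxE exchange_big /=; apply: eq_bigr => f _; rewrite !mxE mulr_suml.
  by apply: eq_bigr => e _; rewrite !mxE; ring.
have : A *m M T *m A^T = A *m M T' *m A^T.
  by rewrite !E//; apply/matrixP => i j; rewrite [LHS]mxE [RHS]mxE h.
move/coframe_inj/(congr1 (mulmx coframe)); rewrite !mulmxA coframeK !mul1mx.
by move/matrixP/(_ c d); rewrite !mxE.
Qed.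

Lemma op_act_kulkarni P Q p q i j :
  P *m A^T = coframe *m diag_mx p -> Q *m A^T = coframe *m diag_mx q ->
  op_act g (kulkarni P Q) (frame_form i j) =
    (p 0 i * q 0 j + q 0 i * p 0 j) *: frame_form i j.
Proof.
move=> PA QA; apply/matrixP => a b; rewrite op_act_frame; last first.
  by move=> ? ? ? ?; rewrite /kulkarni; ring.
have E (X : 'M[R]_n) x : X *m A^T = coframe *m diag_mx x ->
    forall k l, \sum_e X k e * A l e = x 0 l * coframe k l.
  move=> XA k l; have /matrixP/(_ k l) := XA;
  rewrite mul_mx_diag [RHS]mxE mxE mulrC => <-.
  by apply: eq_bigr => e _; rewrite mxE.
rewrite mxE frame_formE.
transitivity ((\sum_e P a e * A i e) * (\sum_f Q b f * A j f) +
  (\sum_e Q a e * A i e) * (\sum_f P b f * A j f) -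
  (\sum_e Q b e * A i e) * (\sum_f P a f * A j f) -
  (\sum_e P b e * A i e) * (\sum_f Q a f * A j f)).
  rewrite !big_distrlr /= -big_split -!sumrB; apply: eq_bigr => e _.
  rewrite -big_split -!sumrB; apply: eq_bigr => f _.
  by rewrite /kulkarni /=; ring.
by rewrite !(E _ _ PA) !(E _ _ QA); ring.
Qed.

Lemma tensor_exp_frame P p : P *m A^T = coframe *m diag_mx p ->
  tensor_exp g P *m A^T = coframe *m diag_mx (map_mx expR p).
Proof.
move=> PA; rewrite /tensor_exp (frame_inv Ag) mulmxA PA.
by rewrite mx_exp_diag ?frame_coK// -!mulmxA (mulmxA A) Ag mulmx1.
Qed.

Lemma frame_diag_sym P p : P *m A^T = coframe *m diag_mx p -> P^T = P.
Proof.
move=> PA; have -> : P = coframe *m diag_mx p *m coframe^T.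
  by apply: coframe_inj; rewrite PA -mulmxA -trmx_mul frame_coK trmx1 mulmx1.
by rewrite trmx_mul trmxK (trmx_mul coframe) tr_diag_mx; exact: mulmxA.
Qed.

End Frame.

(** * Weyl-free logarithms and square factors *)

Lemma same_sign (R : realDomainType) n (q : 'rV[R]_n) :
  (1 < n)%N -> (forall i j, i != j -> 0 < q 0 i * q 0 j) ->
  exists s : R, (s = 1 \/ s = -1) /\ forall i, 0 < s * q 0 i.
Proof.
move=> n1 qq; have n0 := ltnW n1.
pose i0 := Ordinal n0; pose i1 := Ordinal n1.
have q01 : 0 < q 0 i0 * q 0 i1 by apply: qq.
have [q0|q0] := ltP 0 (q 0 i0).
  exists 1; split=> [|i]; first by left.
  rewrite mul1r; have [->//|/qq] := eqVneq i i0.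
  by rewrite pmulr_lgt0.
have {}q0 : q 0 i0 < 0.
  by rewrite lt_neqAle q0 andbT; apply: contraTneq q01 => ->; rewrite mul0r ltxx.
exists (-1); split=> [|i]; first by right.
rewrite mulN1r oppr_gt0; have [->//|/qq] := eqVneq i i0.
by rewrite nmulr_lgt0.
Qed.

Section SquareFactors.
Variables (R : realType) (n : nat) (g : 'M[R]_n).
Hypothesis ig : inner_product g.
Hypothesis hn : (3 <= n)%N.
Implicit Types (T L : tensor4 R n) (w P Q : 'M[R]_n).

Lemma op_act_square_factor T Pi (A : 'M[R]_n) q : square_factor T Pi ->
  A *m g *m A^T = 1%:M -> Pi *m A^T = g *m A^T *m diag_mx q ->
  forall i j, op_act g T (frame_form g A i j) =
    (q 0 i * q 0 j) *: frame_form g A i j.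
Proof.
move=> [_ fT] Ag Piq i j.
have -> : T = (fun a b c d => 2^-1 * kulkarni Pi Pi a b c d).
  by do 4!apply/funext => ?; rewrite fT /kulkarni; field.
have -> : op_act g (fun a b c d => 2^-1 * kulkarni Pi Pi a b c d) (frame_form g A i j) =
    2^-1 *: op_act g (kulkarni Pi Pi) (frame_form g A i j).
  apply/matrixP => a b; rewrite [RHS]mxE !(op_act_frame ig Ag).
  - rewrite mulr_sumr; apply: eq_bigr => e _; rewrite mulr_sumr.
    by apply: eq_bigr => f _; rewrite -mulrA.
  - by move=> ? ? ? ?; rewrite /kulkarni; ring.
  - by move=> ? ? ? ?; rewrite /kulkarni; ring.
by rewrite (op_act_kulkarni ig Ag _ _ Piq Piq) scalerA; congr (_ *: _); field.
Qed.

Lemma ricci_kulkarni P : P^T = P ->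
  ricci g (kulkarni g P) = (n%:R - 2) *: P + trace_g g P *: g.
Proof.
move=> sP; have [sg _] := ig; have gU := metric_unit ig.
have hg : invmx g *m g = 1%:M by rewrite mulVmx.
apply/matrixP => i j; rewrite !mxE.
transitivity (\sum_k ((invmx g *m g) k k * P i j + (invmx g *m P) k k * g i j
   - (P i k * (invmx g *m g) k j) - (g i k * (invmx g *m P) k j))).
  apply: eq_bigr => k _; rewrite !mxE !mulr_suml !mulr_sumr -big_split /= -!sumrB.
  by apply: eq_bigr => l _; rewrite /kulkarni; ring.
rewrite !sumrB big_split /= -!mulr_suml hg.
rewrite -[\sum_(k < n) (1%:M : 'M[R]_n) k k]/(\tr _) mxtrace1.
rewrite -[\sum_(k < n) (invmx g *m P) k k]/(\tr _).
have -> : \sum_k P i k * (1%:M : 'M[R]_n) k j = P i j.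
  by rewrite -[in RHS](mulmx1 P) mxE.
have -> : \sum_k g i k * (invmx g *m P) k j = P i j.
  by rewrite -[in RHS](mulKVmx gU P) [RHS]mxE.
have -> : trace_g g P = \tr (invmx g *m P).
  apply: eq_bigr => a _; rewrite mxE; apply: eq_bigr => b _.
  by rewrite -[in RHS]sP mxE.
ring.
Qed.

(** The Ricci contraction of the product is (n - 2) P + (tr P) g and its trace is
2 (n - 1) tr P, so that the trace term cancels; n - 2 and n - 1 must be
invertible. *)
Lemma schouten_kulkarni P : P^T = P -> schouten g (kulkarni g P) = P.
Proof.
move=> sP; have gU := metric_unit ig; have [sg _] := ig.
have n2 : (n%:R - 2 : R) != 0.
  by rewrite subr_eq0 eqr_nat; apply/eqP => nE; have := hn; rewrite nE.
have n1 : (n%:R - 1 : R) != 0.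
  by rewrite subr_eq0 pnatr_eq1; apply/eqP => nE; have := hn; rewrite nE.
have tg : trace_g g g = n%:R.
  rewrite -(mxtrace1 R n) -(mulVmx gU); apply: eq_bigr => a _.
  by rewrite mxE; apply: eq_bigr => b _; congr (_ * _); rewrite -{1}sg mxE.
have tD c X d Y : trace_g g (c *: X + d *: Y) = c * trace_g g X + d * trace_g g Y.
  rewrite /trace_g !mulr_sumr -big_split; apply: eq_bigr => a _ /=.
  rewrite !mulr_sumr -big_split; apply: eq_bigr => b _ /=.
  by rewrite !mxE; ring.
rewrite /schouten /scalar_curvature ricci_kulkarni// tD tg.
apply/matrixP => a b; rewrite !mxE; field.
by rewrite n1 n2.
Qed.

Lemma schouten_sym T : selfadjoint_tensor T -> (schouten g T)^T = schouten g T.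
Proof.
move=> [aT aT' sT]; have [sg _] := ig.
rewrite /schouten linearZ linearB /= linearZ /= sg; congr (_ *: (_ - _)).
apply/matrixP => i j; rewrite !mxE exchange_big /=; apply: eq_bigr => k _.
apply: eq_bigr => l _; rewrite sT; congr (_ * _).
by rewrite -[in LHS](invmx_metric_sym ig) mxE.
Qed.

Lemma weyl_zero_kulkarni L : (forall a b c d, weyl g L a b c d = 0) ->
  L = kulkarni g (schouten g L).
Proof.
move=> w0; apply/funext => a; apply/funext => b; apply/funext => c; apply/funext => d.
apply/eqP; rewrite -subr_eq0; apply/eqP.
by rewrite -[RHS](w0 a b c d) /weyl /kulkarni; ring.
Qed.

Lemma kulkarni_weyl_zero L P : P^T = P -> L = kulkarni g P ->
  schouten g L = P /\ forall a b c d, weyl g L a b c d = 0.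
Proof.
move=> sP LE; have SP : schouten g L = P by rewrite LE schouten_kulkarni.
by split=> // a b c d; rewrite /weyl SP LE /kulkarni; ring.
Qed.

Variable T : tensor4 R n.
Hypothesis sT : selfadjoint_tensor T.
Hypothesis pT : op_posdef g T.
Let L := op_log g T.

(** Pi has eigenvalues q_i of a common sign s, as the q_i q_j are eigenvalues of T;
P is the logarithm of s Pi. *)
Lemma square_factor_log Pi : square_factor T Pi ->
  exists P, [/\ P^T = P, L = kulkarni g P &
    Pi = tensor_exp g P \/ Pi = - tensor_exp g P].
Proof.
move=> fT; have [sPi _] := fT.
have [A [q [Ag PA]]] := frame_exists ig sPi.
have opT := op_act_square_factor fT Ag PA.
have [s [s1 sq]] : exists s : R, (s = 1 \/ s = -1) /\ forall i, 0 < s * q 0 i.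
  apply: same_sign => [|i j ij]; first exact: ltnW.
  apply: pT; exists (frame_form g A i j); split=> //.
    exact: frame_form_two.
  exact: frame_form_neq0.
have ss : s * s = 1 by case: s1 => ->; rewrite ?mulrNN mulr1.
pose p := map_mx (fun x => ln (s * x)) q.
pose P := g *m A^T *m diag_mx p *m (g *m A^T)^T.
have PE : P *m A^T = g *m A^T *m diag_mx p.
  by rewrite /P -(mulmxA _ _ A^T) -trmx_mul frame_coK// trmx1 mulmx1.
have sP := frame_diag_sym Ag PE.
have [sL LT] := op_logP ig sT.
exists P; split=> //.
  do 4!apply/funext => ?; apply: (frame_ext ig Ag) => [? ? ? ?|? ? ? ?|i j].
  - by case: sL.
  - by rewrite /kulkarni; ring.
  rewrite (LT (q 0 i * q 0 j)); [|exact: frame_form_two|exact: opT].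
  (* All eigenvalues of g relative to itself are 1. *)
  have gA : g *m A^T = g *m A^T *m diag_mx (const_mx 1).
    by rewrite diag_const_mx mulmx1.
  rewrite (op_act_kulkarni ig Ag i j gA PE) !mxE mul1r mulr1 addrC -lnM ?posrE//.
  by rewrite mulrACA ss mul1r.
have E : s *: Pi = tensor_exp g P.
  apply: (coframe_inj Ag); rewrite (tensor_exp_frame Ag PE) -scalemxAl PA.
  rewrite scalemxAr; congr (_ *m _).
  have -> : map_mx expR p = s *: q.
    by apply/rowP => i; rewrite !mxE lnK// posrE.
  by rewrite linearZ.
rewrite -E; case: s1 => ->; [left|right]; first by rewrite scale1r.
by rewrite scaleN1r opprK.
Qed.

Lemma kulkarni_square_factor P : P^T = P -> L = kulkarni g P ->
  square_factor T (tensor_exp g P).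
Proof.
move=> sP LE; have [A [p [Ag PA]]] := frame_exists ig sP.
have PiA := tensor_exp_frame Ag PA.
split; first exact: (frame_diag_sym Ag PiA).
pose S : tensor4 R n := fun a b c d => tensor_exp g P a c * tensor_exp g P b d -
  tensor_exp g P a d * tensor_exp g P b c.
apply: (@frame_ext _ _ _ ig _ Ag T S) => [? ? ? ?|? ? ? ?|i j].
- by case: sT.
- by rewrite /S; ring.
have fS : square_factor S (tensor_exp g P).
  by split=> //; exact: (frame_diag_sym Ag PiA).
rewrite (op_act_square_factor fS Ag PiA).
have gA : g *m A^T = g *m A^T *m diag_mx (const_mx 1).
  by rewrite diag_const_mx mulmx1.
have LA := op_act_kulkarni ig Ag i j gA PA; rewrite -LE in LA.
rewrite (op_log_exp ig sT pT (op_logP ig sT) (frame_form_two g A i j) LA).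
by rewrite !mxE mul1r mulr1 expRD mulrC.
Qed.

End SquareFactors.

Theorem theorem4p4 (R : realType) (n : nat) (g : 'M[R]_n) (Rm : tensor4 R n)
    (hn : (3 <= n)%N) (hg : inner_product g) (hRm : curvature_tensor Rm)
    (hpos : op_posdef g Rm) :
  let Rs := op_log g Rm in
  let weyl_zero := forall a b c d, weyl g Rs a b c d = 0 in
  let E := tensor_exp g (schouten g Rs) in
  ((exists Pi : 'M[R]_n, square_factor Rm Pi) <-> weyl_zero) /\
  (weyl_zero ->
     forall Pi : 'M[R]_n, square_factor Rm Pi <-> (Pi = E \/ Pi = - E)).
Proof.
move=> Rs weyl_zero E; have [sR _] := hRm.
have [sL _] := op_logP hg sR.
have factorE : weyl_zero -> square_factor Rm E.
  move=> /weyl_zero_kulkarni; apply: kulkarni_square_factor => //; exact: schouten_sym.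
split.
  split=> [[Pi /(square_factor_log hg hn sR hpos)[P [sP LE _]]]|/factorE h].
    by have [] := kulkarni_weyl_zero hg hn sP LE.
  by exists E.
move=> /factorE fE Pi; split.
  move=> /(square_factor_log hg hn sR hpos)[P [sP LE PiE]].
  by have [SP _] := kulkarni_weyl_zero hg hn sP LE; rewrite /E SP.
case=> -> //; have [sE RE] := fE; split; first by rewrite linearN /= sE.
by move=> p i j k; rewrite RE !mxE; ring.
Qed.
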